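(* For every fixed $d\ge 0$ there exists a constant $c=c(d)$ such that, for $G_n\sim G\big(n,\lceil d(n-1)/2\rceil\big)$, $$\Pr\big[G_n \text{ is not monotone } (c,\mathcal{S}_d,\ln^2)\text{-tiny}\big] < 200\sqrt{d/n}.$$
   Context: $G(n,m)$ is the uniform distribution on simple graphs on vertex set $[n]$ with exactly $m$ edges. For a graph $G$, $s_k(G)$ is the number of unlabeled (isomorphism classes of) $k$-vertex subgraphs of $G$. A class is tiny if it is hereditary and for some constant $\gamma$ contains at most $\gamma^n$ unlabeled $n$-vertex graphs for every $n$. For a constant $c$, a tiny class $\mathcal{Y}$ and a non-decreasing unbounded function $t$, an $n$-vertex graph $G$ is monotone $(c,\mathcal{Y},t)$-tiny if (1) for every integer $1\le k\le t(n)$, every $k$-vertex subgraph of $G$ belongs to $\mathcal{Y}$, and (2) for every integer $k$ with $t(n)<k\le n$, $s_k(G)\le c^k$. Here $\ln^2$ denotes the function $n\mapsto(\ln n)^2$. For $d\ge0$, $\mathcal{S}_d$ is the class of all graphs $G$ such that for every integer $k$ with $1000^{10(d+1)}\le k\le |V(G)|$, every $k$-vertex subgraph of $G$ has at most $k-1+k/\ln k$ edges.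
   Formalization: For d = 0 the strict bound Pr < 200·sqrt(0/n) = 0 is impossible, so in that case the formal theorem states Pr = 0 instead; for every d > 0 the strict inequality is stated as given, for all n ≥ 1. *)

(* Defs.v *)
From HB Require Import structures.
From mathcomp Require Import all_boot all_order all_algebra.
From mathcomp Require Import fingroup perm.
From mathcomp Require Import boolp reals exp.
Set Implicit Arguments. Unset Strict Implicit. Unset Printing Implicit Defensive.
Import Order.TTheory GRing.Theory Num.Theory.
Local Open Scope ring_scope.

Definition is_graph (V : finType) (U : {set V}) (F : {set {set V}}) : bool :=
  [forall e in F, (#|e| == 2)%N && (e \subset U)].

Definition subgraph (V : finType) (W : {set V}) (F' : {set {set V}})
    (U : {set V}) (F : {set {set V}}) : bool :=
  [&& W \subset U, F' \subset F & [forall e in F', e \subset W]].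

Definition ksubgraphs (V : finType) (U : {set V}) (F : {set {set V}}) (k : nat)
  : {set ({set V} * {set {set V}})} :=
  [set X | subgraph X.1 X.2 U F & #|X.1| == k].

(* Isomorphism of two graphs living in the same ambient finite type V:
   some permutation of V maps vertex set onto vertex set and edge set onto
   edge set (any bijection W -> W' extends to a permutation of V). *)
Definition giso (V : finType) (X Y : {set V} * {set {set V}}) : Prop :=
  exists p : {perm V}, (p : V -> V) @: X.1 = Y.1 /\ [set (p : V -> V) @: (e : {set V}) | e in X.2] = Y.2.

Definition s_k (V : finType) (U : {set V}) (F : {set {set V}}) (k : nat) : nat :=
  #|[set [set Y in ksubgraphs U F k | `[< giso X Y >]] | X in ksubgraphs U F k]|.

Definition in_S (R : realType) (d : R) (V : finType) (U : {set V})
    (F : {set {set V}}) : Prop :=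
  forall k : nat, (1000 : R) `^ (10 * (d + 1)) <= k%:R -> (k <= #|U|)%N ->
    forall (W : {set V}) (F' : {set {set V}}), subgraph W F' U F -> #|W| = k ->
      (#|F'|%:R : R) <= k%:R - 1 + k%:R / ln (k%:R : R).

Definition monotone_tiny_Sd (R : realType) (c d : R) (n : nat)
    (E : {set {set 'I_n}}) : Prop :=
  (forall k : nat, (1 <= k)%N -> (k%:R : R) <= (ln (n%:R : R)) ^+ 2 ->
     forall (W : {set 'I_n}) (F' : {set {set 'I_n}}),
       subgraph W F' [set: 'I_n] E -> #|W| = k -> in_S d W F') /\
  (forall k : nat, (ln (n%:R : R)) ^+ 2 < k%:R -> (k <= n)%N ->
     ((s_k [set: 'I_n] E k)%:R : R) <= c ^+ k).

Definition Gnm (n m : nat) : {set {set {set 'I_n}}} :=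
  [set E | is_graph [set: 'I_n] E & #|E| == m].

Definition prob_Gnm (R : realType) (n : nat) (m : int)
    (P : {set {set 'I_n}} -> Prop) : R :=
  (#|[set E in Gnm n `|m|%N | `[< P E >]]|%:R) / (#|Gnm n `|m|%N|%:R).

Arguments in_S {R} d {V} U F.
Arguments monotone_tiny_Sd {R} c d {n} E.
Arguments prob_Gnm {R} n m P.

(* Main.v *)
Require Import Defs.
From HB Require Import structures.
From mathcomp Require Import all_boot all_order all_algebra.
From mathcomp Require Import fingroup perm.
From mathcomp Require Import boolp reals sequences exp.
From mathcomp Require Import zify ring lra.
Set Implicit Arguments. Unset Strict Implicit. Unset Printing Implicit Defensive.
Import Order.TTheory GRing.Theory Num.Theory.

(* Up to isomorphism a connected graph on j vertices is given by the word of 2j - 1 bits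
   recording a breadth-first search, together with the set of the remaining (excess) edges,
   written as pairs of positions in the search order. If for every 0 < j <= k at most b^j such
   codes occur in a graph, then splitting off one component at a time shows that it has at most
   (2b)^k unlabeled k-vertex subgraphs. The number of codes that occur is bounded
   - for bounded j trivially;
   - for larger j <= ln^2 n because the excess is at most j / ln j, unless some j vertices span
     more than j - 1 + j / ln j edges, which a first-moment estimate makes unlikely;
   - for j > ln^2 n by Markov's inequality: with p = m / C(n,2) <= 2d/n, the expected number of
     occurrences is at most n^j 2^(2j-1) p^(j-1) (1+p)^(j^2) <= n B^j with B depending only on d.
   For n below a threshold depending on d the constant c can be chosen to make the second
   condition of monotone tininess trivial. *)

(** * Coding subgraphs up to isomorphism *)

Lemma giso_trans (V : finType) (Y X Z : {set V} * {set {set V}}) :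
  giso X Y -> giso Y Z -> giso X Z.
Proof.
case=> p [h1 h2] [q [h3 h4]]; exists (p * q)%g; split.
  by rewrite -h3 -h1 -imset_comp; apply: eq_imset => x; rewrite permM.
rewrite -h4 -h2 -imset_comp; apply: eq_imset => e /=.
by rewrite -imset_comp; apply: eq_imset => x; rewrite permM.
Qed.

(** Both lists are completed to enumerations of [V] by appending the missing elements; the
    permutation matches equal positions. *)
Lemma perm_extend (V : finType) (x0 : V) (s s' : seq V) :
  uniq s -> uniq s' -> size s = size s' ->
  exists p : {perm V}, forall i, i < size s -> p (nth x0 s i) = nth x0 s' i.
Proof.
move=> us us' ss.
pose ext (r : seq V) := r ++ [seq x <- enum V | x \notin r].
have uext r : uniq r -> uniq (ext r).
  move=> ur; rewrite cat_uniq ur filter_uniq ?enum_uniq // andbT /=.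
  by apply/hasPn => x; rewrite mem_filter => /andP[].
have mext r x : x \in ext r.
  by rewrite mem_cat mem_filter mem_enum andbT; case: (x \in r).
have sext r : uniq r -> size (ext r) = #|V|.
  move=> ur; rewrite cardT; apply/perm_size/uniq_perm => //; first exact: uext.
    exact: enum_uniq.
  by move=> x; rewrite mext mem_enum.
have inj : injective (fun x => nth x0 (ext s') (index x (ext s))).
  move=> x y /eqP; rewrite nth_uniq ?uext //.
  - move=> /eqP e; rewrite -(nth_index x0 (mext s x)) e.
    by rewrite nth_index.
  - by rewrite sext // -(sext s) // index_mem.
  - by rewrite sext // -(sext s) // index_mem.
exists (perm inj) => i hi; rewrite permE.
have -> : nth x0 s i = nth x0 (ext s) i by rewrite nth_cat hi.
rewrite index_uniq ?uext ?nth_cat -?ss ?hi //.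
by rewrite size_cat; apply: leq_trans hi (leq_addr _ _).
Qed.

Section Codes.
Variables (V : finType) (x0 : V).
Implicit Types (s : seq V) (g : seq (nat * nat)) (E F : {set {set V}}) (W : {set V}).

(* Graphs are coded by lists of pairs of positions a < b in an enumeration s of their vertices. *)
Definition pair_edge s (ab : nat * nat) : {set V} :=
  [set nth x0 s ab.1; nth x0 s ab.2].

Definition edges s g : {set {set V}} := [set e in [seq pair_edge s ab | ab <- g]].

Definition wfcode (k : nat) g := all (fun ab => ab.1 < ab.2 < k) g.

Definition coded (X : {set V} * {set {set V}}) s g :=
  [/\ uniq s, X.1 = [set x in s], X.2 = edges s g & wfcode (size s) g].

Lemma edgesP s g e :
  reflect (exists2 ab, ab \in g & e = pair_edge s ab) (e \in edges s g).
Proof. by rewrite inE; apply: (iffP mapP). Qed.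

Lemma edges_cat s g1 g2 : edges s (g1 ++ g2) = edges s g1 :|: edges s g2.
Proof. by apply/setP => e; rewrite !inE map_cat mem_cat. Qed.

Lemma pair_edge_inj s ab cd : uniq s ->
  ab.1 < ab.2 < size s -> cd.1 < cd.2 < size s ->
  pair_edge s ab = pair_edge s cd -> ab = cd.
Proof.
case: ab cd => [a b] [c d] us /= /andP[ab bs] /andP[cd ds] /setP e.
have as_ := ltn_trans ab bs; have cs := ltn_trans cd ds.
have := e (nth x0 s a); have := e (nth x0 s b).
have := e (nth x0 s c); have := e (nth x0 s d).
rewrite !inE !nth_uniq // !eqxx /= => h1 h2 h3 h4.
by congr pair; lia.
Qed.

Lemma card_edges s g : uniq s -> uniq g -> wfcode (size s) g ->
  #|edges s g| = size g.
Proof.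
move=> us ug /allP wg; rewrite cardsE.
rewrite (card_uniqP _) ?size_map // map_inj_in_uniq //.
move=> x y /wg wx /wg wy; exact: pair_edge_inj.
Qed.

(** The permutation carrying [s] to [s'] position by position carries along the edges, which both
    graphs read off the same [g]. *)
Lemma coded_giso X Y s s' g : size s = size s' ->
  coded X s g -> coded Y s' g -> giso X Y.
Proof.
move=> ss [us x1 x2 wf] [us' y1 y2 _].
have [p hp] := perm_extend x0 us us' ss.
exists p; split.
  rewrite x1 y1; apply/setP => y; apply/imsetP/idP => [[x]|].
    rewrite !inE => /(nthP x0)[i hi <-] ->.
    by rewrite hp // mem_nth // -ss.
  rewrite inE => /(nthP x0)[i hi <-]; rewrite -ss in hi.
  by exists (nth x0 s i); rewrite ?inE ?mem_nth ?hp.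
have he ab : ab \in g -> (p : V -> V) @: pair_edge s ab = pair_edge s' ab.
  move=> /(allP wf) /andP[h1 h2].
  by rewrite imsetU1 imset_set1 !hp // (ltn_trans h1 h2).
rewrite x2 y2; apply/setP => e; apply/imsetP/edgesP => [[e' /edgesP[ab hab ->]] ->|].
  by exists ab => //; rewrite he.
by move=> [ab hab ->]; exists (pair_edge s ab); rewrite ?he //; apply/edgesP; exists ab.
Qed.

Lemma s_k_le_codes W F k (L : seq (seq (nat * nat))) :
  (forall X, X \in ksubgraphs W F k -> exists s g, g \in L /\ coded X s g) ->
  s_k W F k <= size L.
Proof.
move=> hL; rewrite /s_k.
(* A class is recovered from any code of any of its members, so the classes are among the values of
   [cls] on [L]. *)
pose cls g := [set Y in ksubgraphs W F k |
  `[< exists X s, [/\ X \in ksubgraphs W F k, coded X s g & giso X Y] >]].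
rewrite -(size_map cls); apply: leq_trans (card_size _).
apply/subset_leq_card/subsetP => _ /imsetP[X hX ->].
have [s [g [gL cX]]] := hL _ hX.
apply/mapP; exists g => //; apply/setP => Y; rewrite !inE.
congr andb; apply: asbool_equiv_eq; split; first by move=> h; exists X, s.
move=> [X' [s' [hX' cX' h]]]; apply: (giso_trans (Y := X')) h.
have sz Z r : Z \in ksubgraphs W F k -> coded Z r g -> size r = k.
  rewrite inE => /andP[_ /eqP <-] [ur -> _ _].
  by rewrite cardsE; move/card_uniqP: ur.
by apply: (coded_giso _ cX cX'); rewrite (sz _ _ hX cX) (sz _ _ hX' cX').
Qed.

(* Reads a breadth-first search as a word: [true] attaches a new vertex, numbered [sz], to the
   current vertex [i]; [false] moves on to the next vertex. *)
Fixpoint tree_of (sz i : nat) (w : seq bool) : seq (nat * nat) :=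
  match w with
  | [::] => [::]
  | true :: w' => (i, sz) :: tree_of sz.+1 i w'
  | false :: w' => tree_of sz i.+1 w'
  end.

(** Invariant of the search: [s] lists the vertices found, and the first [i] of them have all their
    neighbours in [s]. Each letter raises [size s + i] by one while both terms stay at most [#|W|],
    so fuel [r] suffices. The new vertices receive consecutive numbers, hence the [iota]. *)
Lemma bfs_extend W F r s i : uniq s -> {subset s <= W} -> i <= size s ->
  #|W|.*2 <= r + size s + i ->
  (forall u v, u \in take i s -> v \in W -> [set u; v] \in F -> v \in s) ->
  exists s' w, let t := tree_of (size s) i w in
   [/\ uniq (s ++ s') /\ {subset s ++ s' <= W},
       forall u v, u \in s ++ s' -> v \in W -> [set u; v] \in F -> v \in s ++ s',
       size w + i = (size s').*2 + size s,
       {subset edges (s ++ s') t <= F} &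
       map snd t = iota (size s) (size s') /\ all (fun ab => ab.1 < ab.2) t].
Proof.
elim: r s i => [|r IH] s i us sW is_ hr cl.
all: have szW : size s <= #|W| by rewrite cardE; apply: uniq_leq_size => // x xs; rewrite mem_enum; apply: sW.
all: have [ei|ni] := eqVneq i (size s).
(* The search ends when every listed vertex has been explored; otherwise [i < size s <= #|W|]
   contradicts empty fuel. *)
1,3: exists [::], [::]; rewrite cats0; split => //=;
  [by move: cl; rewrite ei take_size | by move=> e /edgesP[]].
- by move: ni; rewrite neq_ltn => /orP[]; lia.
have {ni} is' : i < size s by rewrite ltn_neqAle ni.
(* An unlisted neighbour of vertex [i] is appended with the letter [true]; if there is none, the
   letter [false] moves to [i.+1]. *)
have [/existsP[v /and3P[vW vs uvF]]|/existsPn nov] :=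
    boolP [exists v, [&& v \in W, v \notin s & [set nth x0 s i; v] \in F]].
  have [|||||s' [w [[us' sW'] cl' sw es [e1 e2]]]] := IH (rcons s v) i.
  - by rewrite rcons_uniq vs.
  - by move=> x; rewrite mem_rcons inE => /orP[/eqP->//|/sW].
  - by rewrite size_rcons ltnW // ltnS.
  - by rewrite size_rcons; lia.
  - move=> u v'; rewrite -cats1 takel_cat // => h1 h2 h3.
    by rewrite mem_cat (cl _ _ h1 h2 h3).
  rewrite -cats1 -catA /= in us' sW' cl' es.
  exists (v :: s'), (true :: w); split => //=.
  - by rewrite size_rcons in sw; rewrite addSn sw; lia.
  - move=> e /edgesP[ab]; rewrite inE => /orP[/eqP -> ->|h ->].
      by rewrite /pair_edge /= !nth_cat is' ltnn subnn.
    by apply: es; apply/edgesP; exists ab => //; rewrite size_cat addn1.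
  - by rewrite size_rcons in e1 e2; rewrite e1 e2 is'.
have [|||s' [w [[us' sW'] cl' sw es [e1 e2]]]] := IH s i.+1 us sW.
- by [].
- by lia.
- move=> u v; rewrite (take_nth x0) // mem_rcons inE => /orP[/eqP ->|]; last exact: cl.
  by move=> vW uvF; have := nov v; rewrite vW uvF andbT /= negbK.
by exists s', (false :: w); split => //=; lia.
Qed.

(** From a single root, [j - 1] letters attach a vertex and [j] letters move on, whence [2j - 1]
    bits. *)
Definition ccode (j : nat) : finType := ((j.*2.-1).-tuple bool * {set 'I_j * 'I_j})%type.

Definition elist j (c : ccode j) : seq (nat * nat) :=
  tree_of 1 0 c.1 ++ [seq (val ab.1, val ab.2) | ab <- enum c.2].

(** These conditions make a code stand for exactly [j - 1 + #|c.2|] distinct edges, the exponent of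
    [p] in the first moment. *)
Definition wf_ccode j (c : ccode j) :=
  [&& size (tree_of 1 0 c.1) == j.-1, uniq (elist c) & wfcode j (elist c)].

(* Every connected j-vertex subgraph of E is isomorphic to one given by a code in this set. *)
Definition conn_codes E j : {set ccode j} :=
  [set c | wf_ccode c &
    [exists s : j.-tuple V, uniq s && (edges s (elist c) \subset E)]].

Lemma size_elist j (c : ccode j) : wf_ccode c -> size (elist c) = j.-1 + #|c.2|.
Proof. by case/and3P => /eqP h _ _; rewrite size_cat h size_map -cardE. Qed.

(** The search from [v] lists its component and yields a spanning tree; the excess set collects the
    other edges inside the component. *)
Lemma component_code W F v : is_graph W F -> v \in W ->
  exists j (s : j.-tuple V) (c : ccode j),
   [/\ 0 < j, uniq s /\ {subset s <= W},
       forall u v, u \in s -> v \in W -> [set u; v] \in F -> v \in s,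
       wf_ccode c &
       edges s (elist c) = [set e in F | e \subset [set x in s]]].
Proof.
move=> /forall_inP gF vW.
have [|||||s' [w [[us sW] cl sw es [e1 e2]]]] := @bfs_extend W F #|W|.*2 [:: v] 0.
- by [].
- by move=> x; rewrite inE => /eqP ->.
- by [].
- by rewrite -addnA leq_addr.
- by move=> u v' /=.
rewrite cat1s in us sW cl es; rewrite [size [:: v]]/= in sw es e1 e2.
pose j := (size s').+1.
have sj : size (v :: s') == j by [].
have wj : size w == j.*2.-1 by rewrite /j; lia.
pose s := Tuple sj.
have sE x : (x \in s) = (x \in v :: s') by [].
set t := tree_of 1 0 w in es e1 e2.
have ut : uniq t by apply: (map_uniq (f := snd)); rewrite e1 iota_uniq.
have wt : wfcode j t.
  apply/allP => ab abt; rewrite (allP e2) //=.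
  by have /(map_f snd) := abt; rewrite e1 mem_iota => /andP[].
pose Q := [set ab : 'I_j * 'I_j | [&& ab.1 < ab.2, pair_edge s (val ab.1, val ab.2) \in F
            & (val ab.1, val ab.2) \notin t]].
exists j, s, ((Tuple wj, Q) : ccode j); split => //.
- apply/and3P; split.
  + by rewrite -(size_map snd) e1 size_iota.
  + rewrite cat_uniq ut map_inj_uniq ?enum_uniq ?andbT /=; last first.
      move=> ab cd [/val_inj ea /val_inj eb].
      by rewrite (surjective_pairing ab) ea eb -surjective_pairing.
    apply/hasPn => x /mapP[ab]; rewrite mem_enum inE => /and3P[_ _ h] ->; exact: h.
  + rewrite /wfcode all_cat; apply/andP; split; first exact: wt.
    apply/allP => x /mapP[ab].
    by rewrite mem_enum inE => /and3P[h _ _] -> /=; rewrite h ltn_ord.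
apply/setP => e; rewrite [RHS]inE; apply/edgesP/idP => [[ab]|].
  have ms a : a < j -> nth x0 s a \in s by move=> aj; rewrite sE mem_nth.
  have sub a b : a < b < j -> pair_edge s (a, b) \subset [set x in s].
    move=> /andP[lab bj]; have aj := ltn_trans lab bj.
    by apply/subsetP => x; rewrite !inE => /orP[] /eqP ->; apply: ms.
  rewrite mem_cat => /orP[abt|/mapP[cd]].
    move=> ->; rewrite es; last by apply/edgesP; exists ab.
    by case: ab abt => a b abt; apply: sub; apply: (allP wt _ abt).
  rewrite mem_enum inE => /and3P[h1 h2 _] -> ->.
  by rewrite h2; apply: sub; rewrite h1 ltn_ord.
case/andP => eF /subsetP es'; have /andP[/cards2P[x [y [xy exy]]] _] := gF e eF.
have key a b : a < b < j -> e = pair_edge s (a, b) ->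
    exists2 ab, ab \in elist ((Tuple wj, Q) : ccode j) & e = pair_edge s ab.
  move=> /andP[ab bj] eab; exists (a, b) => //; rewrite mem_cat.
  have aj := ltn_trans ab bj.
  case: (boolP ((a, b) \in t)) => [abt|nt]; first by apply/orP; left.
  apply/orP; right; apply/mapP; exists (Ordinal aj, Ordinal bj) => //.
  by rewrite mem_enum inE /= ab nt -eab eF.
have /(nthP x0)[a ha hax] : x \in (s : seq V) by have := es' x; rewrite exy !inE eqxx => ->.
have /(nthP x0)[b hb hby] : y \in (s : seq V) by have := es' y; rewrite exy !inE eqxx orbT => ->.
rewrite size_tuple in ha hb.
case: (ltngtP a b) => [ab|ab|ab].
- by apply: (key a b); rewrite ?ab ?hb // exy /pair_edge /= hax hby.
- by apply: (key b a); rewrite ?ab ?ha // exy /pair_edge /= hax hby setUC.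
- by move: xy; rewrite -hax -hby ab eqxx.
Qed.

Definition shift_code j g := [seq (ab.1 + j, ab.2 + j) | ab <- g].

Lemma coded_cat W1 W2 F1 F2 s1 s2 g1 g2 : [disjoint W1 & W2] ->
  coded (W1, F1) s1 g1 -> coded (W2, F2) s2 g2 ->
  coded (W1 :|: W2, F1 :|: F2) (s1 ++ s2) (g1 ++ shift_code (size s1) g2).
Proof.
move=> dis [u1 /= W1E F1E w1] [u2 /= W2E F2E w2]; split => /=.
- rewrite cat_uniq u1 u2 andbT /=; apply/hasPn => x xs2; apply/negP => xs1.
  move/pred0P: dis => /(_ x) /=; rewrite W1E W2E !inE xs2 andbT.
  by rewrite xs1.
- by apply/setP => x; rewrite W1E W2E !inE mem_cat.
- rewrite edges_cat F1E F2E; congr setU.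
    apply/setP => e; apply/edgesP/edgesP => -[ab h ->]; exists ab => //;
    have /andP[h1 h2] := allP w1 _ h; rewrite /pair_edge !nth_cat h2 (ltn_trans h1 h2) //.
  apply/setP => e; apply/edgesP/edgesP => [[ab h ->]|[_ /mapP[ab h ->] ->]].
    exists (ab.1 + size s1, ab.2 + size s1); first exact: map_f.
    by rewrite /pair_edge /= !nth_cat !ltnNge !leq_addl /= !addnK.
  by exists ab => //; rewrite /pair_edge /= !nth_cat !ltnNge !leq_addl /= !addnK.
- rewrite /wfcode all_cat; apply/andP; split; apply/allP.
    by move=> ab /(allP w1); rewrite size_cat; lia.
  by move=> _ /mapP[ab /(allP w2) h ->]; rewrite size_cat /=; lia.
Qed.

(* The argument [r] is recursion fuel; [r >= k] suffices. *)
Fixpoint graph_codes E (r k : nat) : seq (seq (nat * nat)) :=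
  match r, k with
  | _, 0 => [:: [::]]
  | 0, _ => [::]
  | r'.+1, _ => flatten [seq
      [seq elist c ++ shift_code j g | c <- enum (conn_codes E j), g <- graph_codes E r' (k - j)]
      | j <- iota 1 k]
  end.

(** Induction: split off the component of some vertex, code the remaining graph recursively, and
    concatenate the codes with shifted positions. *)
Lemma graph_codes_cover E r k W F : k <= r -> is_graph W F -> F \subset E -> #|W| = k ->
  exists s g, g \in graph_codes E r k /\ coded (W, F) s g.
Proof.
elim: r k W F => [|r IH] [|k] W F // kr gF FE Wk.
1,2: exists [::], [::]; split => //; split => //=;
  [ by move/cards0_eq: Wk => ->; apply/setP => x; rewrite !inE
  | have /forall_inP gF' := gF; apply/setP => e; rewrite !inE; apply/negP => /gF' /andP[/eqP e2];
    move/cards0_eq: Wk => ->; rewrite subset0 => /eqP e0; by rewrite e0 cards0 in e2].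
have /card_gt0P[v vW] : 0 < #|W| by rewrite Wk.
have [j [s [c [j0 [us sW] cl wf es]]]] := component_code gF vW.
pose W1 := [set x in (s : seq V)].
have W1W : W1 \subset W by apply/subsetP => x; rewrite inE => /sW.
have W1j : #|W1| = j by rewrite cardsE (card_uniqP us) size_tuple.
have jk : j <= k.+1 by rewrite -W1j -Wk subset_leq_card.
pose F2 := [set e in F | e \subset W :\: W1].
(* As [s] is closed under adjacency, an edge with one end in [s] lies inside [s], so no edge
   crosses. *)
have FE' : F = edges s (elist c) :|: F2.
  rewrite es; apply/setP => e; rewrite !inE -andb_orr.
  have [eF|//] := boolP (e \in F); symmetry.
  have /forall_inP /(_ e eF) /andP[/cards2P[x [y [xy exy]]] eW] := gF.
  have [xW yW] : x \in W /\ y \in W.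
    by split; apply: (subsetP eW); rewrite exy !inE eqxx ?orbT.
  have [xs|xs] := boolP (x \in s).
    have ys : y \in s by apply: (cl x) => //; rewrite -exy.
    by apply/orP; left; apply/subsetP => z; rewrite exy !inE => /orP[] /eqP ->.
  have ys : y \notin s by apply: contra xs => ys; apply: (cl y) => //; rewrite setUC -exy.
  by apply/orP; right; apply/subsetP => z; rewrite exy !inE => /orP[] /eqP ->; rewrite ?xs ?ys.
have [||||s2 [g2 [g2L c2]]] := IH (k.+1 - j) (W :\: W1) F2.
- by lia.
- apply/forall_inP => e; rewrite inE => /andP[eF ->]; rewrite andbT.
  by have /forall_inP /(_ e eF) /andP[] := gF.
- by apply: subset_trans FE; apply/subsetP => e; rewrite inE => /andP[].
- by rewrite cardsD (setIidPr W1W) Wk W1j.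
exists (s ++ s2), (elist c ++ shift_code j g2); split.
  apply/flattenP; exists [seq elist c ++ shift_code j g | c <- enum (conn_codes E j), g <- graph_codes E r (k.+1 - j)].
    by apply/mapP; exists j => //; rewrite mem_iota; lia.
  apply/allpairsP; exists (c, g2); split => //; rewrite mem_enum inE wf /=.
  apply/existsP; exists s; rewrite us; apply: subset_trans FE.
  by rewrite FE' subsetUl.
have -> : W = W1 :|: (W :\: W1) by rewrite setDE setUIr setUCr setIT; apply/esym/setUidPr.
rewrite FE' -[X in shift_code X _](size_tuple s); apply: coded_cat => //.
  by apply/pred0P => x; rewrite /= !inE; case: (x \in s).
by split => //=; case/and3P: wf => _ _; rewrite size_tuple.
Qed.

(** Codes whose first component has [j] vertices number at most [b^j (2b)^(k-j) = 2^(k-j) b^k], and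
    the powers of two sum to less than [2^k] over [1 <= j <= k]. *)
Lemma size_graph_codes E r k b : (forall j, 0 < j <= k -> #|conn_codes E j| <= b ^ j) ->
  size (graph_codes E r k) <= (2 * b) ^ k.
Proof.
elim: r k => [|r IH] [|k] hb //.
have -> : graph_codes E r.+1 k.+1 = flatten [seq
      [seq elist c ++ shift_code j g | c <- enum (conn_codes E j), g <- graph_codes E r (k.+1 - j)]
      | j <- iota 1 k.+1] by [].
rewrite size_flatten /shape -map_comp sumnE big_map.
have {}IH j : 0 < j <= k.+1 -> size (graph_codes E r (k.+1 - j)) <= (2 * b) ^ (k.+1 - j).
  by move=> jk; apply: IH => i ik; apply: hb; lia.
have hj j : 0 < j <= k.+1 ->
    #|conn_codes E j| * size (graph_codes E r (k.+1 - j)) <= 2 ^ (k.+1 - j) * b ^ k.+1.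
  move=> jk; apply: leq_trans (leq_mul (hb j jk) (IH j jk)) _.
  by rewrite expnMn mulnCA -expnD subnKC // ; case/andP: jk.
rewrite (eq_bigr (fun j => #|conn_codes E j| * size (graph_codes E r (k.+1 - j)))); last first.
  by move=> j _; rewrite /= size_allpairs -cardE.
have -> : iota 1 k.+1 = index_iota 1 k.+2 by rewrite /index_iota subn1.
apply: (@leq_trans (\sum_(1 <= j < k.+2) 2 ^ (k.+1 - j) * b ^ k.+1)).
  by rewrite !big_nat; apply: leq_sum => j jk; apply: hj; lia.
rewrite -big_distrl /= expnMn leq_mul2r; apply/orP; right.
rewrite big_nat_rev /= big_add1 /= big_mkord.
rewrite (eq_bigr (fun i : 'I_k.+1 => 2 ^ i)) => [|i _]; last by congr expn; have := ltn_ord i; lia.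
by elim: k {IH hj hb} => [|k IH]; rewrite ?big_ord1 // big_ord_recr /=; move: IH; rewrite !expnS; lia.
Qed.

Lemma s_k_le_conn_codes E k b : is_graph [set: V] E ->
  (forall j, 0 < j <= k -> #|conn_codes E j| <= b ^ j) ->
  s_k [set: V] E k <= (2 * b) ^ k.
Proof.
move=> /forall_inP gE hb; apply: leq_trans (size_graph_codes k hb).
apply: s_k_le_codes => -[W F]; rewrite inE => /andP[/and3P[/= _ FE /forall_inP FW] /eqP Wk].
apply: graph_codes_cover => //; apply/forall_inP => e eF; rewrite FW // andbT.
by have /andP[] := gE e (subsetP FE _ eF).
Qed.

End Codes.

(** * First moments in G(n,m) *)

Lemma leq_bin_expn n k : 'C(n, k) <= n ^ k.
Proof.
apply: leq_trans (_ : n ^_ k <= _).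
  by rewrite -bin_ffact leq_pmulr // fact_gt0.
rewrite ffact_prod -[X in n ^ X]card_ord -prod_nat_const.
by apply: leq_prod => i _; apply: leq_subr.
Qed.

(** The quotient of the two binomials is the product of [(m-i)/(N-i)] for [i < t], and each factor
    is at most [m/N]. *)
Lemma bin_sub_le N m t : t <= m <= N ->
  'C(N - t, m - t) * N ^ t <= m ^ t * 'C(N, m).
Proof.
case/andP=> tm mN; elim: t tm => [|t IH] tm; first by rewrite !subn0 !expn0 mul1n muln1.
have Nt : 0 < N - t by lia.
have e : (N - t) * 'C(N - t.+1, m - t.+1) = (m - t) * 'C(N - t, m - t).
  by rewrite !subnS mul_bin_diag prednK ?subn_gt0.
have {}IH := IH (ltnW tm).
have h : (m - t) * N <= (N - t) * m.
  by rewrite !mulnBl (mulnC m N) leq_sub2l // leq_mul2l mN orbT.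
rewrite -(leq_pmul2l Nt) mulnA e !expnS.
have := leq_mul h IH.
by rewrite (mulnACA (m - t)) (mulnACA (N - t)) !mulnA (mulnAC (N - t) m).
Qed.

Section Gnm.
Variables (n m : nat).
Local Notation V := 'I_n.
Let M := [set e : {set V} | #|e| == 2].

Lemma mem_Gnm E : (E \in Gnm n m) = (E \subset M) && (#|E| == m).
Proof.
rewrite inE; congr andb; apply/forall_inP/subsetP => h e /h; rewrite ?inE ?subsetT ?andbT //.
Qed.

Lemma card_Gnm : #|Gnm n m| = 'C('C(n, 2), m).
Proof.
rewrite -[n in RHS]card_ord -card_draws -cards_draws.
by apply: eq_card => E; rewrite mem_Gnm inE.
Qed.

(** Deleting [T] maps the graphs containing [T] injectively to sets of [m - #|T|] pairs outside
    [T]. *)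
Lemma card_Gnm_super (T : {set {set V}}) :
  #|[set E in Gnm n m | T \subset E]| * 'C(n, 2) ^ #|T| <= m ^ #|T| * #|Gnm n m|.
Proof.
have [->|[E0]] := set_0Vmem [set E in Gnm n m | T \subset E]; first by rewrite cards0.
rewrite inE mem_Gnm => /andP[/andP[E0M /eqP E0m] TE0].
have cM : #|M| = 'C(n, 2) by rewrite card_draws card_ord.
have mN : m <= 'C(n, 2) by rewrite -E0m -cM subset_leq_card.
have Tm : #|T| <= m by rewrite -E0m subset_leq_card.
have TM := subset_trans TE0 E0M.
rewrite card_Gnm; apply: leq_trans (bin_sub_le (t := #|T|) _); last by rewrite Tm.
rewrite leq_mul2r; apply/orP; right.
have -> : 'C(n, 2) - #|T| = #|M :\: T| by rewrite cardsD (setIidPr TM) cM.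
rewrite -cards_draws -(card_in_imset (f := fun E => E :\: T)); last first.
  move=> E E'; rewrite !inE => /andP[_ TE] /andP[_ TE'] eE.
  by rewrite -(setID E T) -(setID E' T) eE (setIidPr TE) (setIidPr TE').
apply/subset_leq_card/subsetP => F /imsetP[E]; rewrite inE mem_Gnm => /andP[/andP[EM /eqP Em] TE] ->.
by rewrite inE setSD //= cardsD (setIidPr TE) Em.
Qed.

End Gnm.

Local Open Scope ring_scope.

Section FirstMoment.
Variables (R : realType).

Lemma sum_expr_card (T : finType) (x : R) :
  \sum_(Q : {set T}) x ^+ #|Q| = (1 + x) ^+ #|T|.
Proof.
rewrite addrC -prodr_const bigA_distr; apply: eq_bigr => Q _.
by rewrite -prodr_const big_mkcond.
Qed.

Variables (n m : nat).
Local Notation V := 'I_n.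
Let p : R := m%:R / ('C(n, 2))%:R.

Lemma Gnm_super_le (T : {set {set V}}) :
  (#|[set E in Gnm n m | T \subset E]|%:R : R) <= p ^+ #|T| * #|Gnm n m|%:R.
Proof.
(* If there are no pairs at all, [p] is [0] by the convention on division, and no graph contains a
   nonempty [T]. *)
have [N0|N0] := posnP 'C(n, 2).
  have [->|T0] := eqVneq T set0.
    rewrite cards0 expr0 mul1r ler_nat subset_leq_card //.
    by apply/subsetP => E; rewrite inE => /andP[].
  suff -> : [set E in Gnm n m | T \subset E] = set0 by rewrite cards0 mulr_ge0 ?exprn_ge0 ?divr_ge0.
  apply/setP => E; rewrite [LHS]inE [RHS]inE mem_Gnm; apply/negP => /andP[/andP[EM _] TE].
  have [e eT] := set0Pn _ T0; have /(subsetP EM) := subsetP TE e eT; rewrite inE => e2.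
  have : (#|[set e : {set V} | #|e| == 2%N]| > 0)%N by apply/card_gt0P; exists e; rewrite inE.
  by rewrite card_draws card_ord N0.
rewrite expr_div_n mulrAC ler_pdivlMr ?exprn_gt0 ?ltr0n //.
by rewrite -!natrX -!natrM ler_nat card_Gnm_super.
Qed.

Lemma card_bigcup_le (T I : finType) (A : I -> {set T}) (Q : pred I) :
  (#|\bigcup_(i | Q i) A i| <= \sum_(i | Q i) #|A i|)%N.
Proof.
elim/big_rec2: _ => [|i y x _ h]; first by rewrite cards0.
by apply: leq_trans (leq_card_setU _ _) _; rewrite leq_add2l.
Qed.

(** Union bound: at most [n^k] vertex sets [W], at most [(k^2)^q] sets of [q] pairs in each, and
    probability at most [p^q] that all these pairs are edges. *)
Lemma dense_Gnm_le k q :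
  (#|[set E in Gnm n m | [exists W : {set V}, (#|W| == k) &&
      (q <= #|[set e in E | e \subset W]|)%N]]|%:R : R)
    <= n%:R ^+ k * (k%:R ^+ 2) ^+ q * p ^+ q * #|Gnm n m|%:R.
Proof.
pose P (W : {set V}) := [set e : {set V} | e \subset W & #|e| == 2%N].
pose D W := [set F : {set {set V}} | F \subset P W & #|F| == q].
pose K := [set W : {set V} | #|W| == k].
set A := [set E in _ | _].
have sub : A \subset \bigcup_(W in K) \bigcup_(F in D W) [set E in Gnm n m | F \subset E].
  apply/subsetP => E; rewrite [E \in A]inE => /andP[EG /existsP[W /andP[Wk qW]]].
  apply/bigcupP; exists W; rewrite ?inE //.
  have [F FW Fq] : exists2 F : {set {set V}}, F \subset [set e in E | e \subset W] & #|F| == q.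
    have : (0 < 'C(#|[set e in E | e \subset W]|, q))%N by rewrite bin_gt0.
    by rewrite -cards_draws => /card_gt0P[F]; rewrite inE => /andP[]; exists F.
  apply/bigcupP; exists F.
    rewrite inE Fq andbT; apply: subset_trans FW _; apply/subsetP => e; rewrite !inE => /andP[eE ->].
    by move: EG; rewrite mem_Gnm => /andP[/subsetP /(_ _ eE)]; rewrite inE.
  rewrite inE EG; apply: subset_trans FW _; apply/subsetP => e.
  by rewrite inE => /andP[].
have card_D W : W \in K -> (#|D W| <= (k ^ 2) ^ q)%N.
  rewrite inE => /eqP Wk; rewrite cards_draws; apply: leq_trans (leq_bin_expn _ _) _.
  have [->//|q0] := posnP q; rewrite leq_exp2r // cards_draws Wk; exact: leq_bin_expn.
have C0 : 0 <= p ^+ q * #|Gnm n m|%:R by rewrite mulr_ge0 // exprn_ge0 // divr_ge0.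
apply: (@le_trans _ _ (\sum_(W in K) \sum_(F in D W) p ^+ q * #|Gnm n m|%:R)).
  apply: le_trans (_ : (\sum_(W in K) \sum_(F in D W)
     #|[set E in Gnm n m | F \subset E]|%N)%:R <= _).
    rewrite ler_nat; apply: leq_trans (subset_leq_card sub) _.
    apply: leq_trans (card_bigcup_le _ _) _.
    by apply: leq_sum => W _; apply: card_bigcup_le.
  rewrite natr_sum; apply: ler_sum => W _; rewrite natr_sum; apply: ler_sum => F.
  by rewrite inE => /andP[_ /eqP <-]; apply: Gnm_super_le.
apply: (@le_trans _ _ (\sum_(W in K) (p ^+ q * #|Gnm n m|%:R) * ((k ^ 2) ^ q)%:R)).
  by apply: ler_sum => W /card_D h; rewrite sumr_const -[leLHS]mulr_natr ler_wpM2l // ler_nat.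
rewrite sumr_const -[leLHS]mulr_natr card_draws card_ord.
have -> : n%:R ^+ k * (k%:R ^+ 2) ^+ q * p ^+ q * #|Gnm n m|%:R =
    p ^+ q * #|Gnm n m|%:R * ((k ^ 2) ^ q)%:R * (n ^ k)%:R by rewrite !natrX; ring.
by apply: ler_wpM2l; [apply: mulr_ge0 | rewrite ler_nat leq_bin_expn].
Qed.

(** An occurring code is counted once per embedding [s]. Each of the [n^j] embeddings costs
    [p^(j-1+#|Q|)], and summing [p^#|Q|] over the excess sets [Q] gives [(1+p)^(j^2)]. *)
Lemma conn_codes_Gnm_le (x0 : V) j : (0 < j)%N ->
  \sum_(E in Gnm n m) (#|conn_codes x0 E j|%:R : R) <=
  n%:R ^+ j * 2 ^+ j.*2.-1 * p ^+ j.-1 * (1 + p) ^+ (j ^ 2) * #|Gnm n m|%:R.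
Proof.
move=> j0.
pose S (E : {set {set V}}) (c : ccode j) (s : j.-tuple V) := edges x0 s (elist c) \subset E.
have p0 : 0 <= p by rewrite divr_ge0.
apply: (@le_trans _ _ (\sum_(E in Gnm n m) \sum_(c : ccode j | wf_ccode c)
    \sum_(s : j.-tuple V | uniq s) ((S E c s)%:R : R))).
  apply: ler_sum => E _; rewrite -sum1_card natr_sum.
  under eq_bigl do rewrite inE.
  rewrite big_mkcondr /=; apply: ler_sum => c wc.
  case: ifP => [/existsP[s /andP[us sE]]|_]; last by apply: sumr_ge0.
  by rewrite (bigD1 s) //= [S _ _ _]sE lerDl; apply: sumr_ge0.
rewrite exchange_big /=.
apply: (@le_trans _ _ (\sum_(c : ccode j) \sum_(s : j.-tuple V)
   p ^+ (j.-1 + #|c.2|) * #|Gnm n m|%:R)).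
  rewrite big_mkcond; apply: ler_sum => c _.
  have nn : 0 <= p ^+ (j.-1 + #|c.2|) * #|Gnm n m|%:R by rewrite mulr_ge0 ?exprn_ge0.
  case: ifP => wc; last by apply: sumr_ge0.
  rewrite exchange_big /= big_mkcond; apply: ler_sum => s _.
  case: ifP => us //.
  have <- : #|edges x0 s (elist c)| = (j.-1 + #|c.2|)%N.
    by rewrite card_edges // ?size_elist //; case/and3P: wc => // _ _; rewrite size_tuple.
  apply: le_trans (Gnm_super_le _); rewrite -natr_sum ler_nat -sum1_card.
  rewrite big_mkcond [leqRHS]big_mkcond; apply: leq_sum => E _.
  by rewrite inE; case: (E \in Gnm n m) => //=; case: (S E c s).
under eq_bigr do rewrite sumr_const card_tuple card_ord -[_ *+ (n ^ j)]mulr_natl exprD.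
rewrite -(pair_bigA _ (fun (w : (j.*2.-1).-tuple bool) (Q : {set 'I_j * 'I_j}) =>
  (n ^ j)%:R * (p ^+ j.-1 * p ^+ #|Q| * #|Gnm n m|%:R))) /=.
rewrite sumr_const card_tuple card_bool -[leLHS]mulr_natl -big_distrr /= -big_distrl /= -big_distrr /=.
rewrite sum_expr_card card_prod card_ord mulnn !natrX.
rewrite le_eqVlt; apply/orP; left; apply/eqP; ring.
Qed.

End FirstMoment.

(** * Real estimates *)

Section Estimates.
Variable R : realType.
Implicit Types (d u y : R).

Lemma ln1000_ge6 : 6 <= ln (1000 : R).
Proof.
rewrite -ler_expR lnK ?posrE //.
have -> : (6 : R) = 30%:R * 5^-1 by field.
rewrite expRM_natl.
(* This follows from [exp(-1/5) >= 1 - 1/5]; then [exp 6 <= (5/4)^30 <= 1000]. *)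
have h : expR (5^-1 : R) <= 5 / 4.
  have := expR_ge1Dx (- 5^-1 : R); rewrite expRN.
  have := expR_gt0 (5^-1 : R); set e := expR _ => e0 h.
  have : (1 - 5^-1) * e <= 1 by rewrite -ler_pdivlMr // mul1r.
  by lra.
apply: (@le_trans _ _ ((5 / 4) ^+ 30)).
  by rewrite lerXn2r ?nnegrE ?expR_ge0 //; lra.
by lra.
Qed.

Lemma expR_half_ge u : 60 <= u -> 24 * u ^+ 2 <= expR (u / 2).
Proof.
move=> hu; have -> : u / 2 = 8%:R * (u / 16) by field.
rewrite expRM_natl.
have h := expR_ge1Dx (u / 16).
apply: (@le_trans _ _ ((1 + u / 16) ^+ 8)); last by rewrite lerXn2r ?nnegrE ?expR_ge0 //; lra.
set v := 1 + u / 16; have hv : 19 / 4 <= v by rewrite /v; lra.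
have -> : u = 16 * (v - 1) by rewrite /v; field.
have v3 : 80 <= v ^+ 3.
  have : (19 / 4) ^+ 3 <= v ^+ 3 by rewrite lerXn2r ?nnegrE //; lra.
  by lra.
have v4 : 80 * v <= v ^+ 4 by rewrite exprSr ler_wpM2r //; lra.
have -> : v ^+ 8 = (v ^+ 4) ^+ 2 by rewrite -exprM.
apply: (@le_trans _ _ ((80 * v) ^+ 2)); last by rewrite lerXn2r ?nnegrE //; lra.
by nra.
Qed.

Lemma expR_ge6M u : 60 <= u -> 6 * u <= expR u.
Proof.
move=> hu; have h := expR_half_ge hu.
have : expR (u / 2) <= expR u by rewrite ler_expR; lra.
by nra.
Qed.

(** With [u = ln k], [y = ln n], [x = 2dk^2/n] and [q = k + r + 1], the term is
    [(2dk^2)^k * x * x^r]. One [x] supplies the square root; the rest is at most [exp(3uk - yr/2)],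
    where [r > k/u - 2] and [y >= 24u^2] bring it below [1/n]. *)
Lemma dense_term_le d (n k q : nat) : 0 < d -> (0 < n)%N ->
  (1000 : R) `^ (10 * (d + 1)) <= k%:R -> (k%:R : R) <= (ln (n%:R : R)) ^+ 2 ->
  k%:R - 1 + k%:R / ln (k%:R : R) < q%:R ->
  n%:R ^+ k * (k%:R ^+ 2) ^+ q * (2 * d / n%:R) ^+ q <= Num.sqrt (d / n%:R) / n%:R.
Proof.
move=> d0 n0 hk kn hq.
have nR0 : 0 < n%:R :> R by rewrite ltr0n.
have kR0 : 0 < k%:R :> R by apply: lt_le_trans hk; rewrite powR_gt0.
set u := ln (k%:R : R) in hq; set y := ln (n%:R : R) in kn.
have ku : k%:R = expR u by rewrite lnK.
have ny : n%:R = expR y by rewrite lnK.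
have hu : 60 * (d + 1) <= u.
  have : ln ((1000 : R) `^ (10 * (d + 1))) <= u by rewrite ler_ln ?posrE ?powR_gt0.
  rewrite ln_powR; have := ln1000_ge6; nra.
have u60 : 60 <= u by lra.
have y0 : 0 <= y by apply: ln_ge0; rewrite ler1n.
have yu : 24 * u ^+ 2 <= y.
  apply: le_trans (expR_half_ge u60) _.
  rewrite -(@ler_pXn2r _ 2) ?nnegrE ?expR_ge0 //.
  suff -> : expR (u / 2) ^+ 2 = k%:R by [].
  by rewrite -expRM_natl ku; congr expR; field.
have e6 := expR_ge6M u60.
have dk : 2 * d <= k%:R by rewrite ku; lra.
have kq : (k < q)%N.
  rewrite -(ltr_nat R); apply: le_lt_trans hq.
  suff : 1 <= k%:R / u by lra.
  by rewrite ler_pdivlMr ?mul1r ?ku; lra.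
have [r eq] : exists r, q = (k + r.+1)%N by exists (q - k.+1)%N; rewrite addnS -addSn subnKC.
set s := Num.sqrt _.
have s0 : 0 <= s by apply: sqrtr_ge0.
have ss : s ^+ 2 = d / n%:R by rewrite sqr_sqrtr // divr_ge0 // ltW.
pose x : R := 2 * d * k%:R ^+ 2 / n%:R.
have x0 : 0 <= x by rewrite /x !mulr_ge0 ?invr_ge0 ?exprn_ge0 //; lra.
have -> : n%:R ^+ k * (k%:R ^+ 2) ^+ q * (2 * d / n%:R) ^+ q =
    (2 * d * k%:R ^+ 2) ^+ k * (x * x ^+ r).
  rewrite -mulrA -exprMn.
  have -> : k%:R ^+ 2 * (2 * d / n%:R) = x by rewrite /x; field; lra.
  rewrite eq (exprD x k) (mulrA _ (x ^+ k)) -exprMn; congr (_ ^+ k * _); last by rewrite exprS.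
  by rewrite /x; field; lra.
have k3 : 2 * d * k%:R ^+ 2 <= expR (3%:R * u).
  by rewrite expRM_natl -ku (exprS _ 2) ler_wpM2r // exprn_ge0 // ltW.
have xy : x <= expR (- (y / 2)).
  apply: (@le_trans _ _ (expR (3%:R * u - y))); last by rewrite ler_expR; nra.
  by rewrite /x expRD expRN -ny ler_wpM2r // invr_ge0 ltW.
have xs : x <= s.
  have -> : x = 2 * k%:R ^+ 2 * s * s by rewrite -mulrA -expr2 ss /x; field; lra.
  rewrite -[leRHS]mul1r ler_wpM2r //.
  suff : (2 * k%:R ^+ 2 * s) ^+ 2 <= 1 ^+ 2.
    by rewrite ler_pXn2r ?nnegrE // mulr_ge0 // mulr_ge0 // exprn_ge0.
  rewrite expr1n exprMn ss.
  rewrite mulrA ler_pdivrMr // mul1r.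
  have -> : (2 * k%:R ^+ 2) ^+ 2 * d = 2 * d * (2 * k%:R ^+ 4) by ring.
  apply: (@le_trans _ _ (k%:R * (k%:R * k%:R ^+ 4))).
    apply: ler_pM => //; first by lra.
      by rewrite mulr_ge0 // exprn_ge0.
    by apply: ler_wpM2r; [exact: exprn_ge0 | rewrite ku; lra].
  by rewrite -!exprS ku ny -expRM_natl ler_expR; nra.
have h1 : (2 * d * k%:R ^+ 2) ^+ k <= expR (3 * u * k%:R).
  rewrite expRM_natr lerXn2r ?nnegrE ?expR_ge0 // !mulr_ge0 ?exprn_ge0 ?ltW //.
have h2 : x ^+ r <= expR (- (y / 2) * r%:R).
  by rewrite expRM_natr lerXn2r ?nnegrE ?expR_ge0.
apply: (@le_trans _ _ (expR (3 * u * k%:R) * (s * expR (- (y / 2) * r%:R)))).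
  have xr := exprn_ge0 r x0.
  apply: (ler_pM _ _ h1 (ler_pM x0 xr xs h2)); last by rewrite mulr_ge0.
  by rewrite exprn_ge0 // mulr_ge0 ?exprn_ge0 //; lra.
rewrite mulrCA ler_wpM2l // -expRD ny -expRN ler_expR.
have hr : k%:R / u - 2 < r%:R.
  move: hq; rewrite eq natrD -addn1 natrD; lra.
pose z := k%:R / u.
have kz : k%:R = z * u by rewrite /z divfK //; lra.
have z6 : 6 <= z by rewrite /z ler_pdivlMr ?ku; lra.
rewrite -/z in hr.
have f1 : 3 * u * k%:R <= y * z / 8.
  rewrite kz; have : z * (24 * u ^+ 2) <= z * y by rewrite ler_wpM2l //; lra.
  by lra.
have f2 : y * (z - 2) <= y * r%:R by rewrite ler_wpM2l //; lra.
have f3 : y * 6 <= y * z by rewrite ler_wpM2l.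
by lra.
Qed.

End Estimates.

(** * The bad events *)

Section Events.
Variables (R : realType) (d : R) (n : nat).
Local Notation V := 'I_n.
Implicit Types E : {set {set V}}.

Definition small_range (k : nat) : bool :=
  ((1000 : R) `^ (10 * (d + 1)) <= k%:R) && ((k%:R : R) <= (ln (n%:R : R)) ^+ 2).

Definition excess_bound (k : nat) : R := k%:R - 1 + k%:R / ln (k%:R : R).

Definition has_dense_spot E : bool :=
  [exists k : 'I_n.+1, small_range k &&
    [exists W : {set V}, (#|W| == k) &&
      (excess_bound k < #|[set e in E | e \subset W]|%:R)]].

Lemma small_range_ge1000 k : 0 <= d -> small_range k -> (1000 <= k)%N.
Proof.
move=> d0 /andP[h _]; rewrite -(ler_nat R); apply: le_trans h.
by apply: le1r_powR; lra.
Qed.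

Lemma excess_bound_ge k : (0 < k)%N -> (k%:R - 1 : R) <= excess_bound k.
Proof.
move=> k0; rewrite /excess_bound lerDl divr_ge0 // ln_ge0 // ler1n //.
Qed.

Lemma dense_spotN E k (W : {set V}) (F : {set {set V}}) :
  ~~ has_dense_spot E -> small_range k -> #|W| = k -> F \subset E ->
  [forall e in F, e \subset W] -> (#|F|%:R : R) <= excess_bound k.
Proof.
move=> /existsPn nd hk Wk FE /forall_inP FW.
have kn : (k < n.+1)%N by rewrite ltnS -Wk -[n in (_ <= n)%N]card_ord max_card.
have := nd (Ordinal kn); rewrite hk /= => /existsPn /(_ W); rewrite Wk eqxx /= -leNgt.
apply: le_trans; rewrite ler_nat; apply/subset_leq_card/subsetP => e eF.
by rewrite inE (subsetP FE) //= FW.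
Qed.

(** A subgraph of a subgraph is a subgraph of [E], and its order is at most [k], hence still at most
    [ln^2 n]. *)
Lemma dense_spotN_in_S E : ~~ has_dense_spot E ->
  forall k : nat, (1 <= k)%N -> (k%:R : R) <= (ln (n%:R : R)) ^+ 2 ->
     forall (W : {set V}) (F : {set {set V}}),
       subgraph W F [set: V] E -> #|W| = k -> in_S d W F.
Proof.
move=> nd k k1 kn W F /and3P[_ FE FW] Wk k' hk' k'W W' F' /and3P[_ F'F F'W'] W'k'.
apply: (dense_spotN nd _ W'k' _ F'W'); last exact: subset_trans FE.
rewrite /small_range hk' /=; apply: le_trans kn.
by rewrite ler_nat -Wk.
Qed.

Lemma dense_spot_prob m : 0 < d -> (0 < n)%N -> m%:R / ('C(n, 2))%:R <= 2 * d / n%:R ->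
  (#|[set E in Gnm n m | has_dense_spot E]|%:R : R)
    <= 2 * Num.sqrt (d / n%:R) * #|Gnm n m|%:R.
Proof.
move=> d0 n0 hp.
have nR0 : 0 < n%:R :> R by rewrite ltr0n.
(* The least integer above the excess bound. *)
pose q k := (Num.truncn (excess_bound k)).+1.
pose D (k : nat) := [set E in Gnm n m | [exists W : {set V}, (#|W| == k) &&
      (q k <= #|[set e in E | e \subset W]|)%N]].
have sub : [set E in Gnm n m | has_dense_spot E] \subset
    \bigcup_(k : 'I_n.+1 | small_range k) D k.
  apply/subsetP => E; rewrite inE => /andP[EG /existsP[k /andP[hk /existsP[W /andP[Wk h]]]]].
  apply/bigcupP; exists k => //; rewrite inE EG /=; apply/existsP; exists W.
  have k3 := small_range_ge1000 (ltW d0) hk.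
  rewrite Wk /= /q truncn_lt_nat //; apply: le_trans (excess_bound_ge _); last by lia.
  by rewrite subr_ge0 ler1n; lia.
have hD k : small_range k -> (#|D k|%:R : R) <= Num.sqrt (d / n%:R) / n%:R * #|Gnm n m|%:R.
  move=> hk; apply: le_trans (dense_Gnm_le _ _ _ _ _) _.
  rewrite ler_wpM2r //; have [hk1 hk2] := andP hk.
  apply: le_trans (dense_term_le (q := q k) d0 n0 hk1 hk2 _); last exact: truncnS_gt.
  rewrite ler_wpM2l ?mulr_ge0 ?exprn_ge0 // lerXn2r ?nnegrE ?divr_ge0 // mulr_ge0 //; lra.
apply: (@le_trans _ _ (\sum_(k : 'I_n.+1 | small_range k) (#|D k|%:R : R))).
  by rewrite -natr_sum ler_nat; apply: leq_trans (subset_leq_card sub) (card_bigcup_le _ _).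
apply: (@le_trans _ _ (\sum_(k : 'I_n.+1) Num.sqrt (d / n%:R) / n%:R * #|Gnm n m|%:R)).
  rewrite big_mkcond; apply: ler_sum => k _; case: ifP => [/hD //|_].
  by rewrite !mulr_ge0 ?sqrtr_ge0 ?invr_ge0.
rewrite sumr_const card_ord -[leLHS]mulr_natl mulrA ler_wpM2r //.
(* There are at most [n + 1 <= 2n] sizes, each contributing [sqrt(d/n)/n]. *)
rewrite mulrCA mulrC ler_wpM2r ?sqrtr_ge0 // ler_pdivrMr // -natr1.
have n1 : 1 <= n%:R :> R by rewrite ler1n.
by lra.
Qed.

Variable x0 : V.

Definition has_many_codes (b : nat) E : bool :=
  [exists j : 'I_n.+1, ((ln (n%:R : R)) ^+ 2 < j%:R) && (b ^ j < #|conn_codes x0 E j|)%N].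

(** The factor [4] pays for the word, [2d + 1] for the powers of [np], and the exponential for
    [(1+p)^j] with [j <= n]. *)
Definition conn_base : R := 4 * (2 * d + 1) * expR (2 * d).

Lemma conn_mean_le (j : nat) (p : R) : 0 <= d -> (0 < j <= n)%N -> 0 <= p -> p <= 2 * d / n%:R ->
  n%:R ^+ j * 2 ^+ j.*2.-1 * p ^+ j.-1 * (1 + p) ^+ (j ^ 2) <= n%:R * conn_base ^+ j.
Proof.
move=> d0 /andP[j0 jn] p0 hp.
have nR0 : 0 < n%:R :> R by rewrite ltr0n (leq_trans j0).
(* One factor [n] has no matching [p]. Using [2d + 1], which is at least [1], lets the exponent
   [j - 1] be raised to [j]. *)
have h1 : n%:R ^+ j * p ^+ j.-1 <= n%:R * (2 * d + 1) ^+ j.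
  rewrite -{1}(prednK j0) exprS -mulrA ler_wpM2l // -exprMn.
  apply: (@le_trans _ _ ((2 * d + 1) ^+ j.-1)).
    rewrite lerXn2r ?nnegrE ?mulr_ge0 //; first by lra.
    by apply: (@le_trans _ _ (2 * d)); [rewrite mulrC -ler_pdivlMr | lra].
  by rewrite ler_weXn2l //; [lra | exact: leq_pred].
have h2 : (2 : R) ^+ j.*2.-1 <= 4 ^+ j.
  have -> : (4 : R) = 2 ^+ 2 by ring.
  by rewrite -exprM ler_weXn2l //; [lra | lia].
have h3 : (1 + p) ^+ (j ^ 2) <= expR (2 * d) ^+ j.
  apply: (@le_trans _ _ (expR p ^+ (j ^ 2))).
    by rewrite lerXn2r ?nnegrE ?expR_ge0 ?expR_ge1Dx // addr_ge0.
  rewrite -!expRM_natl ler_expR natrX expr2 -mulrA ler_wpM2l //.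
  apply: (@le_trans _ _ (j%:R * (2 * d / n%:R))); first by rewrite ler_wpM2l.
  have -> : j%:R * (2 * d / n%:R) = 2 * d * (j%:R / n%:R) by field; lra.
  by apply: ler_piMr; [lra | rewrite ler_pdivrMr // mul1r ler_nat].
have -> : n%:R ^+ j * 2 ^+ j.*2.-1 * p ^+ j.-1 * (1 + p) ^+ (j ^ 2) =
   (n%:R ^+ j * p ^+ j.-1) * (2 ^+ j.*2.-1 * (1 + p) ^+ (j ^ 2)) by ring.
have -> : n%:R * conn_base ^+ j = (n%:R * (2 * d + 1) ^+ j) * (4 ^+ j * expR (2 * d) ^+ j).
  by rewrite /conn_base !exprMn; ring.
have p1 : 0 <= 1 + p by lra.
by apply: ler_pM; rewrite ?mulr_ge0 ?exprn_ge0 //; apply: ler_pM; rewrite ?exprn_ge0.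
Qed.

(** By Markov's inequality a size [j] fails with probability at most [n exp(-4j)]. As
    [j > y^2 >= y], this is at most [n^-2]; the sum over sizes is at most [2/n], which [n d >= 1]
    turns into [2 sqrt(d/n)]. *)
Lemma many_codes_prob m b : 0 < d -> 1 <= n%:R * d -> 1 <= ln (n%:R : R) ->
  m%:R / ('C(n, 2))%:R <= 2 * d / n%:R -> expR 4 * conn_base <= b%:R ->
  (#|[set E in Gnm n m | has_many_codes b E]|%:R : R)
    <= 2 * Num.sqrt (d / n%:R) * #|Gnm n m|%:R.
Proof.
move=> d0 nd n1 hp hb.
have n0 : (0 < n)%N by case: (n) x0 => [[]|].
have nR0 : 0 < n%:R :> R by rewrite ltr0n.
set y := ln _ in n1.
have ny : n%:R = expR y by rewrite lnK.
have B0 : 0 < conn_base by rewrite /conn_base !mulr_gt0 ?expR_gt0 //; lra.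
pose D (j : nat) := [set E in Gnm n m | (b ^ j < #|conn_codes x0 E j|)%N].
have hD j : (j <= n)%N -> y ^+ 2 < j%:R -> (#|D j|%:R : R) <= (n%:R ^+ 2)^-1 * #|Gnm n m|%:R.
  move=> jn yj.
  have j0 : (0 < j)%N by rewrite -(ltr_nat R); apply: le_lt_trans yj; exact: sqr_ge0.
  have markov : (#|D j|%:R : R) * b%:R ^+ j <= \sum_(E in Gnm n m) (#|conn_codes x0 E j|%:R : R).
    rewrite -natrX mulr_natl -sumr_const -natr_sum -natr_sum ler_nat.
    rewrite big_mkcond [leqRHS]big_mkcond; apply: leq_sum => E _; rewrite inE.
    by case: (E \in Gnm n m) => //=; case: ifP => // /ltnW.
  have h : (#|D j|%:R : R) * b%:R ^+ j <= n%:R * conn_base ^+ j * #|Gnm n m|%:R.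
    apply: le_trans markov _; apply: le_trans (conn_codes_Gnm_le _ _ _ j0) _.
    rewrite ler_wpM2r // conn_mean_le ?j0 ?divr_ge0 //; lra.
  have h2 : (#|D j|%:R : R) * (expR 4 ^+ j * conn_base ^+ j) <= n%:R * conn_base ^+ j * #|Gnm n m|%:R.
    apply: le_trans h; rewrite ler_wpM2l // -exprMn lerXn2r // nnegrE //.
    by rewrite mulr_ge0 ?expR_ge0 // ltW.
  have h3 : (#|D j|%:R : R) * expR 4 ^+ j <= n%:R * #|Gnm n m|%:R.
    rewrite -(ler_pM2r (exprn_gt0 j B0)) -mulrA; apply: le_trans h2 _.
    by rewrite mulrAC.
  rewrite mulrC ler_pdivlMr ?exprn_gt0 //.
  have yj' : n%:R ^+ 3 <= expR 4 ^+ j :> R.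
    rewrite ny -!expRM_natl ler_expR; nra.
  rewrite -(ler_pM2l nR0); apply: le_trans h3; rewrite mulrCA -exprS.
  by rewrite ler_wpM2l.
have sub : [set E in Gnm n m | has_many_codes b E] \subset
    \bigcup_(j : 'I_n.+1 | y ^+ 2 < j%:R) D j.
  apply/subsetP => E; rewrite inE => /andP[EG /existsP[j /andP[hj h]]].
  by apply/bigcupP; exists j => //; rewrite inE EG.
apply: (@le_trans _ _ (\sum_(j : 'I_n.+1 | y ^+ 2 < j%:R) (#|D j|%:R : R))).
  by rewrite -natr_sum ler_nat; apply: leq_trans (subset_leq_card sub) (card_bigcup_le _ _).
apply: (@le_trans _ _ (\sum_(j : 'I_n.+1) (n%:R ^+ 2)^-1 * #|Gnm n m|%:R)).
  rewrite big_mkcond; apply: ler_sum => j _; case: ifP => [/hD|_]; first by apply; rewrite -ltnS.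
  by rewrite mulr_ge0 ?invr_ge0 ?exprn_ge0.
rewrite sumr_const card_ord -[leLHS]mulr_natl mulrA ler_wpM2r //.
have s1 : n%:R^-1 <= Num.sqrt (d / n%:R).
  rewrite -(@ler_pXn2r _ 2) ?nnegrE ?sqrtr_ge0 ?invr_ge0 //.
  rewrite sqr_sqrtr; last by rewrite divr_ge0 // ltW.
  by rewrite ler_pdivlMr // exprVn expr2 invfM -mulrA mulVf ?lt0r_neq0 // mulr1 -[leLHS]mul1r ler_pdivrMr // mulrC.
apply: (@le_trans _ _ (2 * n%:R^-1)); last by rewrite ler_wpM2l.
rewrite expr2 invfM mulrA ler_wpM2r ?invr_ge0 // ler_pdivrMr // -natr1.
have nn1 : 1 <= n%:R :> R by rewrite ler1n.
by lra.
Qed.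

(** All codes together number [2^(2j-1) 2^(j^2)], and [j^2 <= Kj]. *)
Lemma conn_codes_le_total E (j K : nat) : (0 < j <= K)%N ->
  (#|conn_codes x0 E j| <= (4 * 2 ^ K) ^ j)%N.
Proof.
case/andP=> j0 jK; apply: leq_trans (max_card _) _.
rewrite card_prod card_tuple card_bool -cardsT -powersetT card_powerset cardsT card_prod card_ord.
rewrite expnMn leq_mul //.
  by rewrite -[4%N]/(2 ^ 2)%N -expnM leq_pexp2l //; lia.
by rewrite -expnM leq_pexp2l // leq_mul2r jK orbT.
Qed.

(** Weights replace a count of small excess sets. With [t = j^-2], an excess of at most [j / ln j]
    gives [t^#|Q| >= exp(-2j)], so the number of codes is at most [exp(2j)] times the sum of
    [t^#|Q|] over all codes, where [(1+t)^(j^2) <= exp 1]. *)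
Lemma conn_codes_le_small E m (j b : nat) : 0 <= d -> E \in Gnm n m -> ~~ has_dense_spot E ->
  small_range j -> 4 * expR 3 <= b%:R :> R -> (#|conn_codes x0 E j| <= b ^ j)%N.
Proof.
move=> d0 EG nd hj hb.
have j3 := small_range_ge1000 d0 hj.
have j0 : (0 < j)%N by lia.
have jR0 : 0 < j%:R :> R by rewrite ltr0n.
set u := ln (j%:R : R).
have ju : j%:R = expR u by rewrite lnK.
have u0 : 0 < u by rewrite ln_gt0 // ltr1n; lia.
pose t : R := (j%:R ^+ 2)^-1.
have tE : t = expR (- (2 * u)) by rewrite /t expRN ju -expRM_natl.
have t0 : 0 < t by rewrite tE expR_gt0.
have key c : c \in conn_codes x0 E j -> 1 <= expR (2 * j%:R) * t ^+ #|c.2|.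
  rewrite inE => /andP[wc /existsP[s /andP[us sE]]].
  have ce : #|edges x0 s (elist c)| = (j.-1 + #|c.2|)%N.
    by rewrite card_edges // ?size_elist //; case/and3P: wc => // _ _; rewrite size_tuple.
  have := @dense_spotN E j [set x in (s : seq V)] _ nd hj _ sE.
  rewrite ce cardsE (card_uniqP us) size_tuple => /(_ erefl) h.
  have {}h : ((j.-1 + #|c.2|)%:R : R) <= excess_bound j.
    apply: h; apply/forall_inP => e /edgesP[ab abc ->].
    case/and3P: wc => _ _ /allP /(_ _ abc) /andP[h1 h2].
    by apply/subsetP => x; rewrite !inE => /orP[] /eqP ->; apply: mem_nth;
       rewrite size_tuple // (ltn_trans h1 h2).
  move: h; rewrite natrD -subn1 natrB // /excess_bound -/u => h.
  have h2 : #|c.2|%:R <= j%:R / u by lra.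
  rewrite tE -expRM_natl -expRD -[leLHS]expR0 ler_expR.
  by rewrite ler_pdivlMr // in h2; lra.
have bound : (#|conn_codes x0 E j|%:R : R) <= expR (2 * j%:R) * (2 ^+ j.*2.-1 * (1 + t) ^+ (j ^ 2)).
  apply: (@le_trans _ _ (\sum_(c : ccode j) expR (2 * j%:R) * t ^+ #|c.2|)).
    rewrite -sum1_card natr_sum big_mkcond; apply: ler_sum => c _.
    by case: ifP => [/key //|_]; rewrite mulr_ge0 ?expR_ge0 ?exprn_ge0 // ltW.
  rewrite -big_distrr /= -(pair_bigA _ (fun (w : (j.*2.-1).-tuple bool) (Q : {set 'I_j * 'I_j}) =>
    t ^+ #|Q|)) /= sumr_const card_tuple card_bool sum_expr_card card_prod card_ord mulnn.
  by rewrite -[(1 + t) ^+ _ *+ _]mulr_natl natrX.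
rewrite -(ler_nat R) natrX; apply: le_trans bound _.
apply: (@le_trans _ _ ((4 * expR 3) ^+ j)); last first.
  by rewrite lerXn2r // nnegrE // mulr_ge0 ?expR_ge0.
have h2 : (2 : R) ^+ j.*2.-1 <= 4 ^+ j.
  have -> : (4 : R) = 2 ^+ 2 by ring.
  by rewrite -exprM ler_weXn2l //; [lra | lia].
have h3 : (1 + t) ^+ (j ^ 2) <= expR 1.
  apply: (@le_trans _ _ (expR t ^+ (j ^ 2))).
    by rewrite lerXn2r ?nnegrE ?expR_ge0 ?expR_ge1Dx // addr_ge0 // ltW.
  by rewrite -expRM_natl natrX /t mulfV // expf_neq0 // lt0r_neq0.
apply: (@le_trans _ _ (expR (2 * j%:R) * (4 ^+ j * expR 1))).
  rewrite ler_wpM2l ?expR_ge0 //; apply: ler_pM => //; rewrite exprn_ge0 //.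
  by rewrite addr_ge0 // ltW.
rewrite mulrCA exprMn ler_wpM2l ?exprn_ge0 // -expRD -expRM_natl ler_expR.
have j1 : 1 <= j%:R :> R by rewrite ler1n.
by lra.
Qed.

Lemma monotone_tiny_of_codes E m (b : nat) (c : R) : 0 <= d -> E \in Gnm n m ->
  ~~ has_dense_spot E -> (forall j, (0 < j <= n)%N -> (#|conn_codes x0 E j| <= b ^ j)%N) ->
  (2 * b)%:R <= c -> monotone_tiny_Sd c d E.
Proof.
move=> d0 EG nd hb hc; split; first exact: dense_spotN_in_S.
move=> k _ kn; apply: (@le_trans _ _ ((2 * b)%:R ^+ k)); last first.
  by rewrite lerXn2r // nnegrE //; apply: le_trans hc.
rewrite -natrX ler_nat; apply: (s_k_le_conn_codes (x0 := x0)).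
  by move: EG; rewrite inE => /andP[].
by move=> j /andP[j0 jk]; apply: hb; rewrite j0 (leq_trans jk).
Qed.

(** Serves the finitely many small [n]: there are at most [2^n 2^(2^n)] pairs of a vertex set and an
    edge set, and [c <= c^k] since [k > 0]. *)
Lemma monotone_tiny_trivial E (c : R) : ~~ has_dense_spot E ->
  (2 ^ n * 2 ^ (2 ^ n))%:R <= c -> monotone_tiny_Sd c d E.
Proof.
move=> nd hc; split; first exact: dense_spotN_in_S.
move=> k nk _.
have k0 : (0 < k)%N by rewrite -(ltr_nat R); apply: le_lt_trans nk; exact: sqr_ge0.
have c1 : 1 <= c by apply: le_trans hc; rewrite ler1n muln_gt0 !expn_gt0.
apply: (@le_trans _ _ c); last by rewrite -[leLHS]expr1 ler_weXn2l.
apply: le_trans hc; rewrite ler_nat; apply: leq_trans (leq_imset_card _ _) _.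
apply: leq_trans (max_card _) _; rewrite card_prod.
by rewrite -!cardsT -!powersetT !card_powerset !cardsT card_ord.
Qed.

End Events.

(** * Degenerate cases and assembly *)

Lemma sparse_no_dense_spot (R : realType) (d : R) n (E : {set {set 'I_n}}) :
  0 <= d -> (#|E| <= 1)%N -> ~~ has_dense_spot d E.
Proof.
move=> d0 E1; apply/existsPn => k; apply/negP => /andP[hk /existsP[W /andP[_ h]]].
have k3 := small_range_ge1000 d0 hk.
(* A dense spot has more than [k - 1 >= 999] edges. *)
have := excess_bound_ge R (ltac:(lia) : (0 < k)%N).
rewrite leNgt => /negP; apply; apply: (lt_le_trans h).
rewrite lerBrDr natr1 ler_nat.
have : (#|[set e in E | e \subset W]| <= #|E|)%N.
  by apply/subset_leq_card/subsetP => e; rewrite inE => /andP[].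
lia.
Qed.

Lemma conn_codes_set0 n (x0 : 'I_n) j : (1 < j)%N -> conn_codes x0 set0 j = set0.
Proof.
move=> j1; apply/setP => c; rewrite [RHS]inE; apply/negP.
rewrite inE => /andP[wc /existsP[s /andP[us]]]; rewrite subset0 => /eqP e0.
have : #|edges x0 s (elist c)| = (j.-1 + #|c.2|)%N.
  by rewrite card_edges // ?size_elist //; case/and3P: wc => // _ _; rewrite size_tuple.
by rewrite e0 cards0; lia.
Qed.

(** Once [d(n-1)/2 >= 1], rounding up at most doubles the number of edges. *)
Lemma edge_density_le (R : realType) (d : R) (n m : nat) : (0 < n)%N ->
  2 <= d * (n - 1)%:R -> m%:R < d * (n - 1)%:R / 2 + 1 ->
  m%:R / ('C(n, 2))%:R <= 2 * d / n%:R.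
Proof.
move=> n0 hd hm.
have n1 : (1 < n)%N.
  by rewrite ltnNge; apply/negP => n1; move: hd; rewrite (_ : n - 1 = 0)%N ?mulr0; [lra | lia].
have nR0 : 0 < n%:R :> R by rewrite ltr0n.
have nR1 : 0 < (n - 1)%:R :> R by rewrite ltr0n subn_gt0.
have N2 : (2 : R) * ('C(n, 2))%:R = n%:R * (n - 1)%:R.
  by rewrite -!natrM; congr _%:R; rewrite bin2 mul2n subn1 halfK oddM; case: n n1 {n0 hd hm nR0 nR1} => // k _ /=; case: (odd k) => //; rewrite subn0.
have NE : ('C(n, 2))%:R = n%:R * (n - 1)%:R / 2 :> R by rewrite -N2; field.
rewrite NE ler_pdivrMr; last by rewrite divr_gt0 ?mulr_gt0.
have -> : 2 * d / n%:R * (n%:R * (n - 1)%:R / 2) = d * (n - 1)%:R by field; lra.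
by lra.
Qed.

Theorem theorem3p1 (R : realType) (d : R) (hd : 0 <= d) :
  exists c : R, forall n : nat, (0 < n)%N ->
    let p : R := prob_Gnm n (Num.ceil (d * (n - 1)%:R / 2))
               (fun E => ~ monotone_tiny_Sd c d E) in
    p < 200 * Num.sqrt (d / n%:R) \/ (d = 0 /\ p = 0).
Proof.
have up (x : R) : exists N : nat, (0 < N)%N /\ x <= N%:R.
  by exists (Num.truncn x).+1; split => //; apply/ltW/truncnS_gt.
(* [K] reaches the threshold of the class; [b1] serves the Markov range and [b2] the middle range.
   The bounds [n1], [n2], [n3] secure [ln n >= 1], [n d >= 1] and [d(n-1) >= 2]. *)
have [K [K0 hK]] := up ((1000 : R) `^ (10 * (d + 1))).
have [b1 [_ hb1]] := up (expR 4 * conn_base d).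
have [b2 [_ hb2]] := up (4 * expR 3).
have [n1 [_ hn1]] := up (expR 1).
have [n2 [_ hn2]] := up (d^-1).
have [n3 [_ hn3]] := up (2 / d + 1).
pose b := (4 * 2 ^ K + b1 + b2)%N.
pose n0 := (n1 + n2 + n3)%N.
(* The first summand is the base for large [n]; the second makes the count trivial for [n < n0]. *)
pose c := (2 * b + 2 ^ n0 * 2 ^ (2 ^ n0))%N.
exists c%:R => n npos; cbv zeta.
have x0 : 'I_n := Ordinal npos.
have nR0 : 0 < n%:R :> R by rewrite ltr0n.
have nR1 : 0 <= (n - 1)%:R :> R by rewrite ler0n.
set z := d * (n - 1)%:R / 2.
have z0 : 0 <= z by rewrite /z divr_ge0 // mulr_ge0.
pose m := `|Num.ceil z|%N.
have mz : m%:R < z + 1 :> R.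
  have c0 : 0 <= Num.ceil z by rewrite ceil_ge0; lra.
  have /andP[h _] := ceil_itv z.
  have -> : (m%:R : R) = (Num.ceil z)%:~R by rewrite /m -[in RHS](gez0_abs c0).
  by move: h; rewrite rmorphB /=; lra.
have bigb : (4 * 2 ^ K <= b)%N by rewrite /b -addnA leq_addr.
have bexp j x : (x <= 4 * 2 ^ K)%N -> (x ^ j <= b ^ j)%N.
  by move=> h; case: j => // j; rewrite leq_exp2r // (leq_trans h).
have cb : (2 * b)%:R <= c%:R :> R by rewrite ler_nat leq_addr.
have hbR1 : expR 4 * conn_base d <= b%:R.
  by apply: le_trans hb1 _; rewrite ler_nat /b addnAC leq_addl.
have hbR2 : 4 * expR 3 <= b%:R :> R.
  by apply: le_trans hb2 _; rewrite ler_nat leq_addl.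
have Ksmall E j : (0 < j <= K)%N -> (#|conn_codes x0 E j| <= b ^ j)%N.
  by move=> hj; apply: leq_trans (conn_codes_le_total x0 E hj) _; apply: bexp.
move: hd; rewrite le_eqVlt => /orP[/eqP d0|d0].
  (* At [d = 0] the bound is [0], so a strict inequality is impossible; the only graph is empty and
     never fails. *)
  right; split=> //.
  have m0 : m = 0%N by rewrite /m /z -d0 !mul0r ceil0.
  rewrite /prob_Gnm -/m.
  suff -> : [set E in Gnm n m | `[< ~ monotone_tiny_Sd c%:R d E >]] = set0 by rewrite cards0 mul0r.
  apply/setP => E; rewrite [LHS]inE [RHS]inE; apply/negP => /andP[EG /asboolP]; apply.
  have E0 : E = set0.
    by move: EG; rewrite mem_Gnm m0 => /andP[_]; rewrite cards_eq0 => /eqP.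
  apply: (monotone_tiny_of_codes (x0 := x0) _ EG _ _ cb); first by rewrite -d0.
    by apply: sparse_no_dense_spot; rewrite -?d0 // E0 cards0.
  move=> j /andP[j0 _]; have [jK|jK] := leqP j K; first by apply: Ksmall; rewrite j0.
  by rewrite E0 conn_codes_set0 ?cards0 //; apply: leq_ltn_trans jK.
left.
set s := Num.sqrt _.
have s0 : 0 < s by rewrite sqrtr_gt0 divr_gt0.
rewrite /prob_Gnm -/m.
set B := [set E in _ | _].
(* If there is no graph with [m] edges, the quotient is [0] by convention. *)
have [->|G0] := eqVneq #|Gnm n m| 0%N; first by rewrite invr0 mulr0 mulr_gt0.
have GR0 : 0 < #|Gnm n m|%:R :> R by rewrite ltr0n lt0n.
rewrite ltr_pdivrMr //.
(* Each of the two bad events contributes at most [2s], well below [200s]. *)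
suff h : (#|B|%:R : R) <= (2 * s + 2 * s) * #|Gnm n m|%:R.
  apply: le_lt_trans h _; rewrite ltr_pM2r //; lra.
have dense : (#|[set E in Gnm n m | has_dense_spot d E]|%:R : R) <= 2 * s * #|Gnm n m|%:R.
  have [h|h] := lerP 2 (d * (n - 1)%:R).
    by apply: dense_spot_prob => //; apply: edge_density_le.
  (* Here [z < 1], so at most one edge is present and no dense spot exists. *)
  have m1 : (m <= 1)%N.
    by rewrite -ltnS -(ltr_nat R); apply: lt_le_trans mz _; rewrite /z; lra.
  suff -> : [set E in Gnm n m | has_dense_spot d E] = set0.
    by rewrite cards0 !mulr_ge0 // ltW.
  apply/setP => E; rewrite [LHS]inE [RHS]inE; apply/negP => /andP[EG]; apply/negP.
  apply: sparse_no_dense_spot; first exact: ltW.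
  by move: EG; rewrite mem_Gnm => /andP[_ /eqP ->].
(* For small [n] the choice of [c] leaves dense spots as the only cause of failure. *)
have [nn0|nn0] := ltnP n n0.
  have sub : B \subset [set E in Gnm n m | has_dense_spot d E].
    apply/subsetP => E; rewrite !inE => /andP[-> /asboolP]; apply: contra_notT.
    move=> nd; apply: monotone_tiny_trivial => //; rewrite ler_nat.
    apply: leq_trans (leq_addl _ _); apply: leq_mul; rewrite leq_pexp2l // ?leq_pexp2l //; exact: ltnW.
  apply: (@le_trans _ _ (#|[set E in Gnm n m | has_dense_spot d E]|%:R)).
    by rewrite ler_nat subset_leq_card.
  apply: le_trans dense _; rewrite ler_wpM2r //; lra.
have nn1 : expR 1 <= n%:R :> R.
  by apply: le_trans hn1 _; rewrite ler_nat; apply: leq_trans nn0; rewrite /n0 -addnA leq_addr.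
have nn2 : d^-1 <= n%:R.
  by apply: le_trans hn2 _; rewrite ler_nat; apply: leq_trans nn0; rewrite /n0 addnAC leq_addl.
have nn3 : 2 / d + 1 <= n%:R.
  by apply: le_trans hn3 _; rewrite ler_nat; apply: leq_trans nn0; rewrite leq_addl.
have many : (#|[set E in Gnm n m | has_many_codes R x0 b E]|%:R : R) <= 2 * s * #|Gnm n m|%:R.
  apply: many_codes_prob => //.
  - by rewrite -ler_pdivrMr // div1r.
  - by rewrite -ler_expR lnK.
  - apply: edge_density_le => //; rewrite mulrC -ler_pdivrMr // natrB //; lra.
have sub : B \subset [set E in Gnm n m | has_dense_spot d E] :|: [set E in Gnm n m | has_many_codes R x0 b E].
  apply/subsetP => E; rewrite !inE => /andP[EG']; rewrite EG' /= => /asboolP; apply: contra_notT.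
  have EG : E \in Gnm n m by rewrite inE.
  rewrite negb_or => /andP[nd nm].
  apply: (monotone_tiny_of_codes (x0 := x0) (ltW d0) EG nd _ cb) => j /andP[j0 jn].
  (* Three ranges of [j]: up to [K] by the trivial count, up to [ln^2 n] by small excess, beyond by
     the absence of many codes. *)
  have [jK|jK] := leqP j K; first by apply: Ksmall; rewrite j0.
  have [jl|jl] := lerP (j%:R : R) (ln (n%:R : R) ^+ 2).
    apply: (conn_codes_le_small (R := R) x0 (ltW d0) EG nd) => //.
    by rewrite /small_range jl andbT (le_trans hK) // ler_nat ltnW.
  have jn' : (j < n.+1)%N by [].
  by move/existsPn: nm => /(_ (Ordinal jn')); rewrite /= jl /= -leqNgt.
rewrite mulrDl; apply: le_trans (lerD dense many).
by rewrite -natrD ler_nat; apply: leq_trans (subset_leq_card sub) (leq_card_setU _ _).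
Qed.
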